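(* Let $L>0$ and let $f:\mathbb{R}\to\mathbb{R}$ be $2\pi$-periodic and $L$-Lipschitz. For $n\ge 2$ even, let $m=(n/2)+1$ and $p=f*\hat J_m$. Then $$\sup_{x\in\mathbb{R}}|f(x)-p(x)|\le \frac{12\log 2}{\pi}\cdot\frac{L}{n+2}+O\left(\frac{\log n}{n^3}\right).$$ Moreover, equality is obtained when $f$ is the $2\pi$-periodic extension to $\mathbb{R}$ of the function $x\mapsto L|x|$ on $[-\pi,\pi]$; that is, for this $f$, $\sup_{x\in\mathbb{R}}|f(x)-p(x)|=\frac{12\log 2}{\pi}\cdot\frac{L}{n+2}+O\left(\frac{\log n}{n^3}\right)$.
   Context: $L$-Lipschitz means $|f(x)-f(y)|\le L|x-y|$ for all $x,y\in\mathbb{R}$. For an integer $m\ge1$, Jackson's kernel is $$J_m(t)=\left(\frac{\sin(mt/2)}{m\sin(t/2)}\right)^4\cdot \mathbf{1}_{[-\pi,\pi]}(t)$$ (with the value at $t=0$ given by continuity, i.e. $J_m(0)=1$), and its normalization is $\hat J_m(t)=J_m(t)\big/\int_{\mathbb{R}}J_m(x)\,dx$. Convolution is $(f*g)(x)=\int_{\mathbb{R}}f(x-t)g(t)\,dt$. $\log$ is the natural logarithm. The $O(\cdot)$ is as $n\to\infty$ (through even $n$), with implied constant depending only on $L$ (not otherwise on $f$). *)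

(* Defs.v *)
From Stdlib Require Import Reals Lra Lia.
From Coquelicot Require Import Coquelicot.
Open Scope R_scope.

Definition lipschitz (L : R) (f : R -> R) : Prop :=
  forall x y : R, Rabs (f x - f y) <= L * Rabs (x - y).

Definition periodic (T : R) (f : R -> R) : Prop :=
  forall x : R, f (x + T) = f x.

(** [T]-periodic function that agrees with [g] on [[-T/2, T/2)], hence on
    [[-T/2, T/2]] whenever [g (T/2) = g (-T/2)]: [x] is translated by the
    multiple of [T] that brings it into that interval. *)
Definition periodic_extension (T : R) (g : R -> R) (x : R) : R :=
  g (x - T * IZR (Int_part (x / T + / 2))).

Lemma periodic_extension_periodic (T : R) (g : R -> R) :
  0 < T -> periodic T (periodic_extension T g).
Proof.
intros HT x; unfold periodic_extension.
replace ((x + T) / T + / 2) with (x / T + / 2 + IZR 1) by (simpl; field; lra).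
assert (H : Int_part (x / T + / 2 + IZR 1) = (Int_part (x / T + / 2) + 1)%Z).
{ symmetry; apply Int_part_spec; rewrite plus_IZR.
  destruct (base_Int_part (x / T + / 2)); lra. }
rewrite H, plus_IZR; f_equal; ring.
Qed.

Lemma periodic_extension_agrees (T : R) (g : R -> R) (x : R) :
  0 < T -> g (T / 2) = g (- (T / 2)) -> - (T / 2) <= x <= T / 2 ->
  periodic_extension T g x = g x.
Proof.
intros HT Hg [H1 [H2 | ->]]; unfold periodic_extension.
- assert (E : x = x / T * T) by (field; lra).
  assert (H : Int_part (x / T + / 2) = 0%Z).
  { symmetry; apply Int_part_spec; simpl; split; nra. }
  rewrite H; f_equal; simpl; ring.
- replace (T / 2 / T + / 2) with (IZR 1) by (simpl; field; lra).
  assert (H : Int_part (IZR 1) = 1%Z).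
  { symmetry; apply Int_part_spec; lra. }
  rewrite H, Hg; f_equal; simpl; field.
Qed.

Definition integral_R (f : R -> R) : R :=
  RInt_gen f (Rbar_locally m_infty) (Rbar_locally p_infty).

Definition convolution (f g : R -> R) (x : R) : R :=
  integral_R (fun t => f (x - t) * g t).

Definition indicator (a b t : R) : R :=
  if Rle_dec a t then if Rle_dec t b then 1 else 0 else 0.

(** The quotient is [0 / 0] at [t = 0], the only zero of [sin (t / 2)] in
    [[-PI, PI]]; there it is given its limit, [1]. *)
Definition jackson (m : nat) (t : R) : R :=
  (if Req_EM_T t 0 then 1 else (sin (INR m * t / 2) / (INR m * sin (t / 2))) ^ 4)
  * indicator (- PI) PI t.

Definition jackson_hat (m : nat) (t : R) : R :=
  jackson m t / integral_R (jackson m).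

Definition sup_dist (f g : R -> R) : Rbar :=
  Lub_Rbar (fun y => exists x : R, y = Rabs (f x - g x)).

Definition bigO_even (r g : nat -> R) : Prop :=
  exists C : R, within Nat.Even eventually (fun n => Rabs (r n) <= C * Rabs (g n)).

Definition jackson_approx (f : R -> R) (n : nat) : R -> R :=
  convolution f (jackson_hat (n / 2 + 1)).

(* Main.v *)
Require Import Defs.
From Stdlib Require Import Reals Lra Lia Psatz.
From Coquelicot Require Import Coquelicot.
Open Scope R_scope.

(** The normalized kernel is nonnegative and has mass one, so the error [f x - p x]
    is the average of [f x - f (x - t)] against it, and for an [L]-Lipschitz [f] it is at
    most [L * E m], where [E m] is the average of [Rabs t]
    ([jackson_approx_error_le]). The triangle wave turns this into an equality at
    [x = 0] ([triangle_wave_error]). Both halves of the theorem therefore hold with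
    the same remainder, the difference between [L * E m] and its main term, and the
    theorem reduces to
    [E m = 6 ln 2 / (PI m) + O(ln m / m^3)] with [2 m = n + 2]
    ([lipschitz_error_asymptotic]).

    [E m] is a quotient. Its denominator is exact: the kernel is, up to the factor
    [m^4], the square of the Fejer kernel, whose Fourier coefficients are known, and
    its integral is [2 PI (2 m^2 + 1) / (3 m^3)] ([is_RInt_kernel]). For the
    numerator, [1 / sin u ^ 4] is replaced by [1 / u ^ 4]; by
    [inv_sin4_sub_inv_pow4] this costs [O(1 / u^2)], that is [O(ln m / m^4)] in the
    integral, and leaves [8 / m^2] times the integral of [sin v ^ 4 / v ^ 3] up to
    [m PI / 2]. Two integrations by parts turn the latter into the Frullani
    integral of [(cos (2v) - cos (4v)) / v], whose value is [ln 2], and the tail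
    beyond [A] is [O(1 / A^2)] because [sin v ^ 4 <= 1] ([RInt_sin4_over_cube]). *)

(** * Jackson's kernel as the square of a trigonometric polynomial *)

(** The quotient [(sin (m t / 2) / sin (t / 2)) ^ 2], written as a sum of Dirichlet
    kernels so that no value has to be patched at the zeros of [sin (t / 2)] and so
    that its integrals against cosines follow by recursion on [m]. Here
    [dirichlet m] is [1 + 2 cos t + ... + 2 cos (m t)]. *)
Fixpoint dirichlet (m : nat) (t : R) : R :=
  match m with
  | O => 1
  | S k => dirichlet k t + 2 * cos (INR (S k) * t)
  end.

Fixpoint fejer (m : nat) (t : R) : R :=
  match m with
  | O => 0
  | S k => fejer k t + dirichlet k t
  end.

Lemma dirichlet_mul_sin (m : nat) (t : R) :
  dirichlet m t * sin (t / 2) = sin ((INR m + / 2) * t).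
Proof.
induction m as [|m IH].
- simpl. rewrite Rmult_1_l. f_equal. field.
- cbn [dirichlet]. rewrite Rmult_plus_distr_r, IH, S_INR.
  replace ((INR m + / 2) * t) with ((INR m + 1) * t - t / 2) by field.
  replace ((INR m + 1 + / 2) * t) with ((INR m + 1) * t + t / 2) by field.
  rewrite sin_minus, sin_plus. ring.
Qed.

(** The sum of the identities [dirichlet k t * sin (t / 2) = sin ((k + 1/2) t)]
    telescopes after multiplication by [sin (t / 2)], because
    [sin ((k+1/2) t) sin (t/2) = sin ((k+1) t / 2) ^ 2 - sin (k t / 2) ^ 2]. *)
Lemma fejer_mul_sin_sqr (m : nat) (t : R) :
  fejer m t * sin (t / 2) ^ 2 = sin (INR m * t / 2) ^ 2.
Proof.
induction m as [|m IH].
- simpl. unfold Rdiv. rewrite !Rmult_0_l, sin_0. ring.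
- cbn [fejer]. rewrite Rmult_plus_distr_r, IH, S_INR.
  replace (dirichlet m t * sin (t / 2) ^ 2)
    with (dirichlet m t * sin (t / 2) * sin (t / 2)) by ring.
  rewrite dirichlet_mul_sin.
  replace ((INR m + / 2) * t) with (INR m * t / 2 + (INR m * t / 2 + t / 2)) by field.
  replace ((INR m + 1) * t / 2) with (INR m * t / 2 + t / 2) by field.
  rewrite !sin_plus, cos_plus.
  set (s := sin (INR m * t / 2)). set (c := cos (INR m * t / 2)).
  set (a := sin (t / 2)). set (b := cos (t / 2)).
  assert (Hsc : c ^ 2 = 1 - s ^ 2).
  { pose proof (sin2_cos2 (INR m * t / 2)) as H. unfold Rsqr in H. fold s c in H. nra. }
  assert (Hab : b ^ 2 = 1 - a ^ 2).
  { pose proof (sin2_cos2 (t / 2)) as H. unfold Rsqr in H. fold a b in H. nra. }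
  replace ((s * b + c * a) ^ 2) with (s ^ 2 * b ^ 2 + 2 * s * c * a * b + c ^ 2 * a ^ 2) by ring.
  replace ((s * (c * b - s * a) + c * (s * b + c * a)) * a)
    with (2 * s * c * a * b + (c ^ 2 - s ^ 2) * a ^ 2) by ring.
  rewrite Hsc, Hab. ring.
Qed.

Lemma dirichlet_0 (m : nat) : dirichlet m 0 = 2 * INR m + 1.
Proof.
induction m as [|m IH].
- simpl. ring.
- cbn [dirichlet]. rewrite IH, Rmult_0_r, cos_0, S_INR. ring.
Qed.

Lemma fejer_0 (m : nat) : fejer m 0 = INR m ^ 2.
Proof.
induction m as [|m IH].
- simpl. ring.
- cbn [fejer]. rewrite IH, dirichlet_0, S_INR. ring.
Qed.

Lemma ex_derive_dirichlet (m : nat) (t : R) : ex_derive (dirichlet m) t.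
Proof.
induction m as [|m IH].
- apply (ex_derive_const 1).
- cbn [dirichlet]. apply (ex_derive_plus (V := R_NormedModule)); [exact IH|]. auto_derive. exact I.
Qed.

Lemma continuous_fejer (m : nat) (t : R) : continuous (fejer m) t.
Proof.
apply (ex_derive_continuous (V := R_NormedModule)).
induction m as [|m IH].
- apply (ex_derive_const 0).
- cbn [fejer]. apply (ex_derive_plus (V := R_NormedModule)); [exact IH | apply ex_derive_dirichlet].
Qed.

(** * The mass of Jackson's kernel *)

Lemma is_RInt_eq (f g : R -> R) (a b u v : R) :
  is_RInt f a b u -> (forall t, f t = g t) -> u = v -> is_RInt g a b v.
Proof.
intros Hf Hfg <-. apply (is_RInt_ext f); [intros; apply Hfg | exact Hf].
Qed.

(** Carrying integrals as [is_RInt] facts lets one linear step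
    give integrability and the value together. *)
Lemma is_RInt_comb (f g : R -> R) (a b c u v : R) :
  is_RInt f a b u -> is_RInt g a b v ->
  is_RInt (fun t => f t + c * g t) a b (u + c * v).
Proof.
intros Hf Hg.
apply (is_RInt_plus (V := R_NormedModule) f (fun t => c * g t)); [exact Hf|].
now apply (is_RInt_scal (V := R_NormedModule) g).
Qed.

Lemma is_RInt_const_R (c a b : R) : is_RInt (fun _ => c) a b ((b - a) * c).
Proof. exact (is_RInt_const (V := R_NormedModule) a b c). Qed.

Lemma is_RInt_cos_period (a : R) :
  a <> 0 -> sin (a * PI) = 0 -> is_RInt (fun t => cos (a * t)) (- PI) PI 0.
Proof.
intros Ha Hs.
evar_last.
- apply (is_RInt_derive (V := R_CompleteNormedModule) (fun t => sin (a * t) / a)).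
  + intros x _. auto_derive; [exact I | field; exact Ha].
  + intros x _. apply (ex_derive_continuous (V := R_NormedModule)). auto_derive. exact I.
- unfold minus, plus, opp; simpl. rewrite Ropp_mult_distr_r_reverse, sin_neg, Hs.
  field. exact Ha.
Qed.

Lemma sin_INR_PI (k : nat) : sin (INR k * PI) = 0.
Proof. apply sin_eq_0_1. exists (Z.of_nat k). now rewrite <- INR_IZR_INZ. Qed.

Lemma is_RInt_const_period (c : R) : is_RInt (fun _ => c) (- PI) PI (2 * PI * c).
Proof. replace (2 * PI * c) with ((PI - - PI) * c) by ring. apply is_RInt_const_R. Qed.

Lemma is_RInt_cos_mul_cos (j k : nat) :
  (0 < j)%nat ->
  is_RInt (fun t => cos (INR j * t) * cos (INR k * t)) (- PI) PI
    (if Nat.eqb j k then PI else 0).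
Proof.
intros Hj.
assert (Hj' : 0 < INR j) by now apply lt_0_INR.
pose proof (pos_INR k) as Hk.
assert (Hplus : is_RInt (fun t => cos ((INR j + INR k) * t)) (- PI) PI 0).
{ apply is_RInt_cos_period; [lra|]. rewrite <- plus_INR. apply sin_INR_PI. }
assert (Hminus : is_RInt (fun t => cos ((INR j - INR k) * t)) (- PI) PI
                   (if Nat.eqb j k then 2 * PI else 0)).
{ destruct (Nat.eqb_spec j k) as [->|Hjk].
  - eapply is_RInt_eq; [apply (is_RInt_const_period 1) | | ring].
    intros t. simpl. replace ((INR k - INR k) * t) with 0 by ring. now rewrite cos_0.
  - apply is_RInt_cos_period.
    + intros H. apply Hjk. apply INR_eq. lra.
    + rewrite Rmult_minus_distr_r, sin_minus, !sin_INR_PI. ring. }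
eapply is_RInt_eq.
- apply (is_RInt_comb _ _ _ _ (/ 2) _ _ (is_RInt_comb _ _ _ _ (/ 2) _ _
           (is_RInt_const_period 0) Hplus) Hminus).
- intros t. simpl. rewrite Rmult_plus_distr_r, Rmult_minus_distr_r, cos_plus, cos_minus. field.
- destruct (Nat.eqb j k); field.
Qed.

Lemma is_RInt_dirichlet_mul_cos (m k : nat) :
  is_RInt (fun t => dirichlet m t * cos (INR k * t)) (- PI) PI
    (if Nat.leb k m then 2 * PI else 0).
Proof.
induction m as [|m IH].
- destruct k as [|k].
  + eapply is_RInt_eq; [apply (is_RInt_const_period 1) | | simpl; ring].
    intros t. simpl. rewrite Rmult_0_l, cos_0. ring.
  + eapply is_RInt_eq; [apply (is_RInt_cos_period (INR (S k))) | | reflexivity].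
    * apply not_0_INR. lia.
    * apply sin_INR_PI.
    * intros t. cbn [dirichlet]. ring.
- eapply is_RInt_eq.
  + apply (is_RInt_comb _ _ _ _ 2 _ _ IH (is_RInt_cos_mul_cos (S m) k (Nat.lt_0_succ m))).
  + intros t. cbn [dirichlet]. ring.
  + destruct (Nat.eqb_spec (S m) k), (Nat.leb_spec k m), (Nat.leb_spec k (S m));
      try lia; ring.
Qed.

(** The Fourier coefficients of the Fejer kernel are the hat function
    [max (m - k) 0]; the truncated subtraction on [nat] is exactly that cut-off. *)
Lemma is_RInt_fejer_mul_cos (m k : nat) :
  is_RInt (fun t => fejer m t * cos (INR k * t)) (- PI) PI (2 * PI * INR (m - k)).
Proof.
induction m as [|m IH].
- eapply is_RInt_eq; [apply (is_RInt_const_period 0) | |].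
  + intros t. simpl. ring.
  + simpl. ring.
- eapply is_RInt_eq.
  + apply (is_RInt_comb _ _ _ _ 1 _ _ IH (is_RInt_dirichlet_mul_cos m k)).
  + intros t. cbn [fejer]. ring.
  + destruct (Nat.leb_spec k m).
    * rewrite Nat.sub_succ_l, S_INR by lia. ring.
    * replace (S m - k)%nat with 0%nat by lia. replace (m - k)%nat with 0%nat by lia. ring.
Qed.

Lemma is_RInt_fejer_mul_dirichlet (m j : nat) :
  (j <= m)%nat ->
  is_RInt (fun t => fejer m t * dirichlet j t) (- PI) PI
    (2 * PI * (INR m + 2 * INR m * INR j - INR j * (INR j + 1))).
Proof.
induction j as [|j IH]; intros Hj.
- eapply is_RInt_eq; [apply (is_RInt_fejer_mul_cos m 0) | |].
  + intros t. simpl. rewrite Rmult_0_l, cos_0. ring.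
  + rewrite Nat.sub_0_r. simpl. ring.
- eapply is_RInt_eq.
  + apply (is_RInt_comb _ _ _ _ 2 _ _ (IH ltac:(lia)) (is_RInt_fejer_mul_cos m (S j))).
  + intros t. cbn [dirichlet]. ring.
  + rewrite minus_INR, S_INR by lia. ring.
Qed.

(** With [F] and [D] for [fejer m] and [dirichlet m], the increment of the
    squared kernel is [(F + D) ^ 2 - F ^ 2 = F D + (F + D) D], and both products
    have known integrals since [F + D] is again a Fejer kernel. *)
Lemma is_RInt_fejer_sqr (m : nat) :
  is_RInt (fun t => fejer m t ^ 2) (- PI) PI
    (2 * PI * (INR m * (2 * INR m ^ 2 + 1) / 3)).
Proof.
induction m as [|m IH].
- eapply is_RInt_eq; [apply (is_RInt_const_period 0) | |].
  + intros t. simpl. ring.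
  + simpl. field.
- eapply is_RInt_eq.
  + apply (is_RInt_comb _ _ _ _ 1 _ _
      (is_RInt_comb _ _ _ _ 1 _ _ IH (is_RInt_fejer_mul_dirichlet m m (Nat.le_refl m)))
      (is_RInt_fejer_mul_dirichlet (S m) m (Nat.le_succ_diag_r m))).
  + intros t. cbn [fejer]. ring.
  + rewrite S_INR. field.
Qed.

(** Jackson's kernel without its cut-off to [[-PI, PI]]: a function that is
    continuous on the whole line, [0] included. *)
Definition kernel (m : nat) (t : R) : R := (fejer m t / INR m ^ 2) ^ 2.

Lemma jackson_eq_kernel (m : nat) (t : R) :
  (0 < m)%nat -> - PI <= t <= PI -> jackson m t = kernel m t.
Proof.
intros Hm [H1 H2]. unfold jackson, indicator, kernel.
assert (Hm' : INR m <> 0) by (apply not_0_INR; lia).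
destruct (Rle_dec (- PI) t) as [_|]; [|lra].
destruct (Rle_dec t PI) as [_|]; [|lra].
destruct (Req_EM_T t 0) as [->|Ht].
- rewrite fejer_0. field. exact Hm'.
- assert (Hs : sin (t / 2) <> 0).
  { destruct (Rtotal_order t 0) as [H|[H|H]]; [|lra|].
    - pose proof (sin_gt_0 (- (t / 2)) ltac:(lra) ltac:(lra)) as Hp.
      rewrite sin_neg in Hp. lra.
    - pose proof (sin_gt_0 (t / 2) ltac:(lra) ltac:(lra)). lra. }
  replace ((sin (INR m * t / 2) / (INR m * sin (t / 2))) ^ 4)
    with ((sin (INR m * t / 2) ^ 2) ^ 2 / (INR m * sin (t / 2)) ^ 4) by (field; auto).
  rewrite <- fejer_mul_sin_sqr. field. auto.
Qed.

Lemma jackson_outside (m : nat) (t : R) : PI < Rabs t -> jackson m t = 0.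
Proof.
intros Ht. unfold jackson, indicator.
destruct (Rle_dec (- PI) t); [|ring].
destruct (Rle_dec t PI); [|ring].
exfalso. revert Ht. apply Rle_not_lt, Rabs_le. lra.
Qed.

Lemma continuous_kernel (m : nat) (t : R) : continuous (kernel m) t.
Proof.
unfold kernel.
apply (continuous_comp (fejer m) (fun y => (y / INR m ^ 2) ^ 2)); [apply continuous_fejer|].
apply (ex_derive_continuous (V := R_NormedModule)).
unfold Rdiv. auto_derive. exact I.
Qed.

Lemma kernel_nonneg (m : nat) (t : R) : 0 <= kernel m t.
Proof. apply pow2_ge_0. Qed.

Definition kernel_mass (m : nat) : R := 2 * PI * (2 * INR m ^ 2 + 1) / (3 * INR m ^ 3).

Lemma kernel_mass_pos (m : nat) : (0 < m)%nat -> 0 < kernel_mass m.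
Proof.
intros Hm. assert (0 < INR m) by now apply lt_0_INR. pose proof PI_RGT_0.
apply Rdiv_lt_0_compat; [nra|]. apply Rmult_lt_0_compat; [lra | now apply pow_lt].
Qed.

Lemma is_RInt_kernel (m : nat) :
  (0 < m)%nat ->
  is_RInt (kernel m) (- PI) PI (kernel_mass m).
Proof.
intros Hm. assert (Hm' : INR m <> 0) by (apply not_0_INR; lia).
eapply is_RInt_eq.
- apply (is_RInt_comb _ _ _ _ (/ INR m ^ 4) _ _ (is_RInt_const_period 0) (is_RInt_fejer_sqr m)).
- intros t. unfold kernel. simpl. field. exact Hm'.
- unfold kernel_mass. field. exact Hm'.
Qed.

(** The cut-off kernel may jump at [-PI] and [PI], so [h] is compared with the
    continuous [g] only on the closed period, and the two outer pieces contribute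
    nothing. *)
Lemma integral_R_supported (h g : R -> R) (v : R) :
  is_RInt g (- PI) PI v ->
  (forall t, - PI <= t <= PI -> h t = g t) ->
  (forall t, PI < Rabs t -> h t = 0) ->
  integral_R h = v.
Proof.
intros Hg Hin Hout. unfold integral_R. pose proof PI_RGT_0 as HPI.
apply (is_RInt_gen_unique (V := R_CompleteNormedModule)).
intros P HP.
apply (Filter_prod _ _ _ (fun a => a < - PI) (fun b => PI < b)).
- exists (- PI). auto.
- exists PI. auto.
- intros a b Ha Hb. exists v. split; [|now apply locally_singleton]. simpl.
  assert (Hzero : forall c d, (forall t, Rmin c d < t < Rmax c d -> PI < Rabs t) ->
                    is_RInt h c d 0).
  { intros c d Hcd.
    apply (is_RInt_ext (fun _ => 0)).
    - intros t Ht. symmetry. apply Hout, Hcd, Ht.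
    - evar_last; [apply is_RInt_const_R | ring]. }
  replace v with (plus (plus 0 v) 0) by (unfold plus; simpl; ring).
  apply (is_RInt_Chasles (V := R_NormedModule) h a PI b).
  + apply (is_RInt_Chasles (V := R_NormedModule) h a (- PI) PI).
    * apply Hzero. intros t. rewrite Rmin_left, Rmax_right by lra. intros Ht.
      rewrite Rabs_left by lra. lra.
    * apply (is_RInt_ext g); [|exact Hg].
      intros t. rewrite Rmin_left, Rmax_right by lra. intros Ht. symmetry. apply Hin. lra.
  + apply Hzero. intros t. rewrite Rmin_left, Rmax_right by lra. intros Ht.
    rewrite Rabs_right by lra. lra.
Qed.

(** * The integral of sin^4 v / v^3 *)

Lemma Rabs_sin_le (v : R) : Rabs (sin v) <= Rabs v.
Proof.
assert (Hpos : forall u, 0 <= u -> Rabs (sin u) <= u).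
{ intros u Hu. apply Rabs_le.
  destruct (Rle_lt_dec 1 u) as [H|H].
  - pose proof (SIN_bound u). lra.
  - pose proof PI2_1. destruct Hu as [Hu| <-]; [|rewrite sin_0; lra].
    pose proof (sin_lt_x u Hu). pose proof (sin_gt_0 u Hu ltac:(lra)). lra. }
destruct (Rle_lt_dec 0 v) as [H|H].
- rewrite (Rabs_right v) by lra. now apply Hpos.
- rewrite <- Rabs_Ropp, <- sin_neg, (Rabs_left v) by lra. apply Hpos. lra.
Qed.

Lemma sin_sqr_le (v : R) : sin v ^ 2 <= v ^ 2.
Proof. rewrite <- !Rsqr_pow2. apply Rsqr_le_abs_1, Rabs_sin_le. Qed.

Lemma sin_sqr_bound (v : R) : 0 <= sin v ^ 2 <= 1.
Proof. pose proof (SIN_bound v). split; nra. Qed.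

Lemma continuous_0_of_le_abs (g : R -> R) :
  (forall v, Rabs (g v) <= Rabs v) -> continuous g 0.
Proof.
intros Hg.
assert (Hg0 : g 0 = 0).
{ specialize (Hg 0). rewrite Rabs_R0 in Hg. apply Rabs_eq_0.
  pose proof (Rabs_pos (g 0)). lra. }
apply continuity_pt_filterlim. intros eps Heps.
exists eps. split; [exact Heps|]. intros x [_ Hx].
simpl in *. unfold Rdist in *. rewrite Hg0. rewrite Rminus_0_r in *.
apply Rle_lt_trans with (Rabs x); auto.
Qed.

(** Both quotients take the value [0 * / 0 = 0] at the origin, which is also
    their limit there: they are continuous without any patching. *)
Definition sin4_over_cube (v : R) : R := sin v ^ 4 / v ^ 3.
Definition sin4_over_id (v : R) : R := sin v ^ 4 / v.

Lemma sin4_over_cube_le (v : R) : Rabs (sin4_over_cube v) <= Rabs v.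
Proof.
unfold sin4_over_cube. destruct (Req_dec v 0) as [->|Hv].
- rewrite sin_0. replace (0 ^ 4 / 0 ^ 3) with 0 by (unfold Rdiv; ring). apply Rle_refl.
- assert (0 < Rabs v) by now apply Rabs_pos_lt.
  unfold Rdiv. rewrite Rabs_mult, Rabs_inv, <- !RPow_abs.
  apply (Rmult_le_reg_r (Rabs v ^ 3)); [now apply pow_lt|].
  rewrite Rmult_assoc, Rinv_l, Rmult_1_r by (apply pow_nonzero; lra).
  apply Rle_trans with (Rabs v ^ 4); [|right; ring].
  apply pow_incr. split; [apply Rabs_pos | apply Rabs_sin_le].
Qed.

Lemma sin4_over_id_le (v : R) : Rabs (sin4_over_id v) <= Rabs v.
Proof.
unfold sin4_over_id. destruct (Req_dec v 0) as [->|Hv].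
- rewrite sin_0. replace (0 ^ 4 / 0) with 0 by (unfold Rdiv; ring). apply Rle_refl.
- assert (0 < Rabs v) by now apply Rabs_pos_lt.
  unfold Rdiv. rewrite Rabs_mult, Rabs_inv.
  apply (Rmult_le_reg_r (Rabs v)); [assumption|].
  rewrite Rmult_assoc, Rinv_l, Rmult_1_r by lra.
  rewrite <- Rabs_mult. rewrite !Rabs_right by nra.
  pose proof (sin_sqr_le v). pose proof (sin_sqr_bound v). nra.
Qed.

Lemma continuous_sin4_over_cube (v : R) : continuous sin4_over_cube v.
Proof.
destruct (Req_dec v 0) as [->|Hv].
- apply continuous_0_of_le_abs, sin4_over_cube_le.
- apply (ex_derive_continuous (V := R_NormedModule)). unfold sin4_over_cube.
  auto_derive. exact (pow_nonzero v 3 Hv).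
Qed.

Lemma continuous_sin4_over_id (v : R) : continuous sin4_over_id v.
Proof.
destruct (Req_dec v 0) as [->|Hv].
- apply continuous_0_of_le_abs, sin4_over_id_le.
- apply (ex_derive_continuous (V := R_NormedModule)). unfold sin4_over_id.
  auto_derive. assumption.
Qed.

Lemma ex_RInt_of_continuous (f : R -> R) (a b : R) :
  (forall v, continuous f v) -> ex_RInt f a b.
Proof. intros H. apply (ex_RInt_continuous (V := R_CompleteNormedModule)). auto. Qed.

Lemma is_RInt_of_continuous (f : R -> R) (a b : R) :
  (forall v, continuous f v) -> is_RInt f a b (RInt f a b).
Proof.
intros H. apply (RInt_correct (V := R_CompleteNormedModule)).
now apply ex_RInt_of_continuous.
Qed.

Lemma RInt_Chasles_R (f : R -> R) (a b c : R) :
  ex_RInt f a b -> ex_RInt f b c -> RInt f a b + RInt f b c = RInt f a c.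
Proof. exact (RInt_Chasles (V := R_CompleteNormedModule) f a b c). Qed.

Lemma is_RInt_abs_le (f g : R -> R) (a b u v : R) :
  a <= b -> is_RInt f a b u -> is_RInt g a b v ->
  (forall x, a < x < b -> Rabs (f x) <= g x) -> Rabs u <= v.
Proof.
intros Hab Hf Hg Hle. apply Rabs_le. split.
- apply (is_RInt_le (fun x => - g x) f a b); auto.
  + now apply (is_RInt_opp (V := R_NormedModule)).
  + intros x Hx. specialize (Hle x Hx). apply Rabs_le_between in Hle. lra.
- apply (is_RInt_le f g a b); auto.
  intros x Hx. specialize (Hle x Hx). apply Rabs_le_between in Hle. lra.
Qed.

Lemma is_RInt_primitive (F f : R -> R) (a b : R) :
  0 < a -> 0 < b ->
  (forall x, 0 < x -> is_derive F x (f x)) -> (forall x, 0 < x -> ex_derive f x) ->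
  is_RInt f a b (F b - F a).
Proof.
intros Ha Hb HF Hf.
assert (Hpos : forall x, Rmin a b <= x <= Rmax a b -> 0 < x).
{ intros x [Hx _]. pose proof (Rmin_glb_lt a b 0 Ha Hb). lra. }
apply (is_RInt_derive (V := R_CompleteNormedModule) F).
- auto.
- intros x Hx. apply (ex_derive_continuous (V := R_NormedModule)). auto.
Qed.

Lemma is_RInt_inv (a b : R) : 0 < a -> 0 < b -> is_RInt (fun x => / x) a b (ln b - ln a).
Proof.
intros Ha Hb. apply is_RInt_primitive; auto.
- intros x Hx. now apply is_derive_ln.
- intros x Hx. auto_derive. lra.
Qed.

Lemma is_RInt_inv_sqr (a b : R) : 0 < a -> 0 < b -> is_RInt (fun x => / x ^ 2) a b (/ a - / b).
Proof.
intros Ha Hb. replace (/ a - / b) with (- / b - - / a) by ring.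
apply (is_RInt_primitive (fun x => - / x)); auto.
- intros x Hx. auto_derive; [lra | field; lra].
- intros x Hx. auto_derive. apply (pow_nonzero x 2); lra.
Qed.

Lemma is_RInt_inv_cube (a b : R) :
  0 < a -> 0 < b -> is_RInt (fun x => / x ^ 3) a b (/ (2 * a ^ 2) - / (2 * b ^ 2)).
Proof.
intros Ha Hb. replace (/ (2 * a ^ 2) - / (2 * b ^ 2)) with (- / (2 * b ^ 2) - - / (2 * a ^ 2)) by ring.
apply (is_RInt_primitive (fun x => - / (2 * x ^ 2))); auto.
- intros x Hx. auto_derive; [nra | field; lra].
- intros x Hx. auto_derive. assert (0 < x ^ 3) by now apply pow_lt. simpl in *. lra.
Qed.

Definition cos2_over_id (v : R) : R := cos (2 * v) / v.

Lemma ex_RInt_cos2_over_id (a b : R) : 0 < a -> 0 < b -> ex_RInt cos2_over_id a b.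
Proof.
intros Ha Hb. apply (ex_RInt_continuous (V := R_CompleteNormedModule)).
intros x [Hx _]. pose proof (Rmin_glb_lt a b 0 Ha Hb).
apply (ex_derive_continuous (V := R_NormedModule)). unfold cos2_over_id. auto_derive. lra.
Qed.

Lemma RInt_cos2_over_id_near_0 (e : R) :
  0 < e -> Rabs (RInt cos2_over_id e (2 * e) - ln 2) <= 4 * e ^ 2.
Proof.
intros He.
pose proof (RInt_correct (V := R_CompleteNormedModule) _ _ _
  (ex_RInt_cos2_over_id e (2 * e) He ltac:(lra))) as H.
pose proof (is_RInt_inv e (2 * e) He ltac:(lra)) as Hinv.
rewrite ln_mult in Hinv by lra.
apply (is_RInt_abs_le (fun x => cos2_over_id x + (-1) * / x) (fun _ => 4 * e) e (2 * e)).
- lra.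
- replace (RInt cos2_over_id e (2 * e) - ln 2)
    with (RInt cos2_over_id e (2 * e) + (-1) * (ln 2 + ln e - ln e)) by ring.
  now apply is_RInt_comb.
- evar_last; [apply is_RInt_const_R | ring].
- intros x Hx. unfold cos2_over_id. rewrite cos_2a_sin.
  replace ((1 - 2 * sin x * sin x) / x + -1 * / x) with (- (2 * sin x ^ 2 * / x)) by (field; lra).
  pose proof (sin_sqr_bound x). pose proof (sin_sqr_le x).
  assert (0 < / x) by (apply Rinv_0_lt_compat; lra).
  rewrite Rabs_Ropp, Rabs_right by nra.
  apply Rle_trans with (2 * x ^ 2 * / x); [nra|].
  replace (2 * x ^ 2 * / x) with (2 * x) by (field; lra). lra.
Qed.

(** One integration by parts: up to an error [sin (2v) / (2 v^2)], the integrand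
    is the derivative of [sin (2v) / (2v)]. *)
Lemma RInt_cos2_over_id_tail (B : R) :
  0 < B -> Rabs (RInt cos2_over_id B (2 * B)) <= / B.
Proof.
intros HB.
pose proof (RInt_correct (V := R_CompleteNormedModule) _ _ _
  (ex_RInt_cos2_over_id B (2 * B) HB ltac:(lra))) as H.
assert (HF : is_RInt (fun v => cos2_over_id v + (-1) * (sin (2 * v) / (2 * v ^ 2))) B (2 * B)
  (sin (2 * (2 * B)) / (2 * (2 * B)) - sin (2 * B) / (2 * B))).
{ apply (is_RInt_primitive (fun v => sin (2 * v) / (2 * v))); [lra | lra | |];
  intros x Hx; unfold cos2_over_id; auto_derive.
  - lra.
  - field; lra.
  - split; [lra|]. split; [nra | exact I]. }
pose proof (is_RInt_comb _ _ _ _ (-1) _ _ H HF) as Hdiff.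
assert (Hle : Rabs (RInt cos2_over_id B (2 * B)
   + -1 * (sin (2 * (2 * B)) / (2 * (2 * B)) - sin (2 * B) / (2 * B))) <= 0 + / 2 * (/ B - / (2 * B))).
{ refine (is_RInt_abs_le _ (fun v => 0 + / 2 * / v ^ 2) B (2 * B) _ _ _ Hdiff _ _).
  - lra.
  - apply is_RInt_comb; [|apply is_RInt_inv_sqr; lra].
    evar_last; [apply is_RInt_const_R | ring].
  - intros x Hx.
    match goal with |- Rabs ?y <= _ => replace y with (sin (2 * x) * (/ 2 * / x ^ 2)) by (field; lra) end.
    assert (0 < / x ^ 2) by (apply Rinv_0_lt_compat, pow_lt; lra).
    rewrite Rabs_mult, (Rabs_right (/ 2 * _)) by nra.
    assert (Rabs (sin (2 * x)) <= 1) by apply Rabs_le, SIN_bound. nra. }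
revert Hle. set (I := RInt cos2_over_id B (2 * B)).
replace (sin (2 * (2 * B)) / (2 * (2 * B))) with (sin (2 * (2 * B)) * / B / 4) by (field; lra).
replace (sin (2 * B) / (2 * B)) with (sin (2 * B) * / B / 2) by (field; lra).
replace (/ (2 * B)) with (/ B / 2) by (field; lra).
pose proof (SIN_bound (2 * (2 * B))). pose proof (SIN_bound (2 * B)).
assert (0 < / B) by now apply Rinv_0_lt_compat.
intros Hle. apply Rabs_le_between in Hle. apply Rabs_le. nra.
Qed.

(** Frullani's argument: [cos (4v) / v] is [cos (2v) / v] dilated by two, so the
    two integrals over [[e, B]] cancel except on [[e, 2e]], which supplies [ln 2], and
    on [[B, 2B]], which is small by oscillation. *)
Lemma frullani_cos (e B : R) :
  0 < e -> 0 < B ->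
  is_RInt (fun v => (cos (2 * v) - cos (4 * v)) / v) e B
    (RInt cos2_over_id e (2 * e) - RInt cos2_over_id B (2 * B)).
Proof.
intros He HB.
pose proof (ex_RInt_cos2_over_id e (2 * e) He ltac:(lra)) as E1.
pose proof (ex_RInt_cos2_over_id (2 * e) (2 * B) ltac:(lra) ltac:(lra)) as E2.
pose proof (ex_RInt_cos2_over_id e B He HB) as E3.
pose proof (ex_RInt_cos2_over_id B (2 * B) HB ltac:(lra)) as E4.
pose proof (RInt_Chasles_R _ _ _ _ E1 E2) as C1.
pose proof (RInt_Chasles_R _ _ _ _ E3 E4) as C2.
assert (Hscale : is_RInt (fun v => 2 * cos2_over_id (2 * v)) e B
                   (RInt cos2_over_id (2 * e) (2 * B))).
{ assert (H := is_RInt_comp_lin (V := R_NormedModule) cos2_over_id 2 0 e B).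
  rewrite !Rplus_0_r in H.
  eapply is_RInt_eq.
  - apply H. apply (RInt_correct (V := R_CompleteNormedModule)). exact E2.
  - intros t. unfold scal; simpl; unfold mult; simpl. now rewrite Rplus_0_r.
  - reflexivity. }
apply (is_RInt_ext (fun v => cos2_over_id v + (-1) * (2 * cos2_over_id (2 * v)))).
- intros x [Hx _]. pose proof (Rmin_glb_lt e B 0 He HB).
  unfold cos2_over_id. replace (2 * (2 * x)) with (4 * x) by ring. simpl. field. lra.
- replace (RInt cos2_over_id e (2 * e) - RInt cos2_over_id B (2 * B))
    with (RInt cos2_over_id e B + (-1) * RInt cos2_over_id (2 * e) (2 * B)) by lra.
  apply is_RInt_comb; [|exact Hscale].
  now apply (RInt_correct (V := R_CompleteNormedModule)).
Qed.

Lemma cos_double_sub_quadruple (v : R) :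
  cos (2 * v) - cos (4 * v) = 2 * (3 * sin v ^ 2 * cos v ^ 2 - sin v ^ 4).
Proof.
replace (4 * v) with (2 * (2 * v)) by ring.
rewrite (cos_2a_sin (2 * v)), cos_2a_sin, sin_2a.
pose proof (sin2_cos2 v) as H. unfold Rsqr in H.
replace (cos v ^ 2) with (1 - sin v ^ 2) by nra.
replace (1 - 2 * (2 * sin v * cos v) * (2 * sin v * cos v))
  with (1 - 8 * sin v ^ 2 * cos v ^ 2) by ring.
replace (cos v ^ 2) with (1 - sin v ^ 2) by nra. ring.
Qed.

(** Boundary terms left by integrating [sin v ^ 4 / v ^ 3] by parts twice; what
    remains is half the second derivative of [sin v ^ 4] over [v], and that half
    is [cos (2v) - cos (4v)]. *)
Definition by_parts_boundary (v : R) : R :=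
  - sin v ^ 4 / (2 * v ^ 2) - 2 * sin v ^ 3 * cos v / v.

Lemma is_RInt_by_parts (e B : R) :
  0 < e -> 0 < B ->
  is_RInt (fun v => sin4_over_cube v + (-1) * ((cos (2 * v) - cos (4 * v)) / v)) e B
    (by_parts_boundary B - by_parts_boundary e).
Proof.
intros He HB. apply is_RInt_primitive; auto.
- intros x Hx. rewrite cos_double_sub_quadruple. unfold by_parts_boundary, sin4_over_cube.
  auto_derive.
  + split; [nra | split; [lra | exact I]].
  + field. lra.
- intros x Hx. unfold sin4_over_cube. auto_derive.
  assert (0 < x ^ 3) by now apply pow_lt. simpl in *. repeat split; lra.
Qed.

Lemma by_parts_boundary_near_0 (e : R) : 0 < e -> Rabs (by_parts_boundary e) <= 3 * e ^ 2.
Proof.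
intros He.
replace (by_parts_boundary e)
  with (- (/ 2 * ((sin e / e) ^ 2 * sin e ^ 2) + 2 * (sin e / e * (sin e ^ 2 * cos e))))
  by (unfold by_parts_boundary; field; lra).
assert (Hq : Rabs (sin e / e) <= 1).
{ unfold Rdiv. rewrite Rabs_mult, Rabs_inv, (Rabs_right e) by lra.
  apply (Rmult_le_reg_r e); [lra|]. rewrite Rmult_assoc, Rinv_l, Rmult_1_r, Rmult_1_l by lra.
  rewrite <- (Rabs_right e) at 2 by lra. apply Rabs_sin_le. }
apply Rabs_le_between in Hq. set (q := sin e / e) in *.
pose proof (sin_sqr_bound e). pose proof (sin_sqr_le e). pose proof (COS_bound e).
set (s2 := sin e ^ 2) in *. set (c := cos e) in *.
assert (0 <= q ^ 2 <= 1) by nra.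
assert (0 <= q ^ 2 * s2 <= e ^ 2) by nra.
assert (- s2 <= s2 * c <= s2) by nra.
assert (Rabs (q * (s2 * c)) <= e ^ 2).
{ rewrite Rabs_mult. assert (Rabs q <= 1) by now apply Rabs_le.
  assert (Rabs (s2 * c) <= e ^ 2) by (apply Rabs_le; lra).
  pose proof (Rabs_pos q). pose proof (Rabs_pos (s2 * c)). nra. }
apply Rabs_le_between in H5. apply Rabs_le. lra.
Qed.

Lemma by_parts_boundary_tail (B : R) : 1 <= B -> Rabs (by_parts_boundary B) <= 3 / B.
Proof.
intros HB.
replace (by_parts_boundary B)
  with ((- (/ 2 * (sin B ^ 4 * / B)) - 2 * (sin B * (sin B ^ 2 * cos B))) * / B)
  by (unfold by_parts_boundary; field; lra).
assert (Hinv : 0 < / B <= 1).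
{ split; [apply Rinv_0_lt_compat; lra|]. rewrite <- Rinv_1. apply Rinv_le_contravar; lra. }
unfold Rdiv. rewrite Rabs_mult, (Rabs_right (/ B)) by lra.
apply Rmult_le_compat_r; [lra|].
pose proof (sin_sqr_bound B). pose proof (SIN_bound B). pose proof (COS_bound B).
replace (sin B ^ 4) with (sin B ^ 2 * sin B ^ 2) by ring.
set (s2 := sin B ^ 2) in *.
assert (0 <= s2 * s2 <= 1) by nra.
assert (0 <= s2 * s2 * / B <= 1) by nra.
assert (-1 <= s2 * cos B <= 1) by nra.
assert (-1 <= sin B * (s2 * cos B) <= 1) by nra.
apply Rabs_le. lra.
Qed.

(** The boundary terms at [B] are only [O(1/B)]. This rate is used solely to
    identify the limit as [ln 2]. The cut-off [e = 1/B] near [0] makes the errors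
    there [O(1/B^2)]. *)
Lemma RInt_sin4_over_cube_weak (B : R) :
  1 <= B -> Rabs (RInt sin4_over_cube 0 B - ln 2) <= 12 / B.
Proof.
intros HB. set (e := / B).
assert (He : 0 < e <= 1).
{ split; [apply Rinv_0_lt_compat; lra|]. unfold e. rewrite <- Rinv_1. apply Rinv_le_contravar; lra. }
assert (E : forall a b, ex_RInt sin4_over_cube a b).
{ intros. apply ex_RInt_of_continuous, continuous_sin4_over_cube. }
pose proof (RInt_Chasles_R _ _ _ _ (E 0 e) (E e B)) as C.
assert (H1 : Rabs (RInt sin4_over_cube 0 e) <= e ^ 2).
{ apply (is_RInt_abs_le sin4_over_cube (fun _ => e) 0 e).
  - lra.
  - apply is_RInt_of_continuous, continuous_sin4_over_cube.
  - evar_last; [apply is_RInt_const_R | ring].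
  - intros x Hx. pose proof (sin4_over_cube_le x) as H.
    rewrite (Rabs_right x) in H by lra. lra. }
assert (H2 : RInt sin4_over_cube e B = by_parts_boundary B - by_parts_boundary e
               + (RInt cos2_over_id e (2 * e) - RInt cos2_over_id B (2 * B))).
{ apply (is_RInt_unique (V := R_CompleteNormedModule)).
  eapply is_RInt_eq.
  - apply (is_RInt_comb _ _ _ _ 1 _ _ (is_RInt_by_parts e B ltac:(lra) ltac:(lra))
             (frullani_cos e B ltac:(lra) ltac:(lra))).
  - intros t. simpl. ring.
  - ring. }
pose proof (by_parts_boundary_near_0 e ltac:(lra)) as H3.
pose proof (by_parts_boundary_tail B HB) as H4.
pose proof (RInt_cos2_over_id_near_0 e ltac:(lra)) as H5.
pose proof (RInt_cos2_over_id_tail B ltac:(lra)) as H6.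
unfold Rdiv in *. fold e in H4, H6. fold e.
assert (e ^ 2 <= e) by nra.
apply Rabs_le_between in H1, H3, H4, H5, H6.
apply Rabs_le. rewrite <- C, H2. lra.
Qed.

(** The true rate is that of the tail of [1 / v ^ 3]. It is recovered from the weak
    rate at the distant point [A ^ 2], where it is already [O(1/A^2)]. *)
Lemma RInt_sin4_over_cube (A : R) :
  1 <= A -> Rabs (RInt sin4_over_cube 0 A - ln 2) <= 13 / A ^ 2.
Proof.
intros HA.
pose proof (RInt_sin4_over_cube_weak (A ^ 2) ltac:(nra)) as H.
assert (E : forall a b, ex_RInt sin4_over_cube a b).
{ intros. apply ex_RInt_of_continuous, continuous_sin4_over_cube. }
pose proof (RInt_Chasles_R _ _ _ _ (E 0 A) (E A (A ^ 2))) as C.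
assert (Htail : Rabs (RInt sin4_over_cube A (A ^ 2)) <= / (2 * A ^ 2) - / (2 * (A ^ 2) ^ 2)).
{ apply (is_RInt_abs_le sin4_over_cube (fun x => / x ^ 3) A (A ^ 2)).
  - nra.
  - apply is_RInt_of_continuous, continuous_sin4_over_cube.
  - apply is_RInt_inv_cube; nra.
  - intros x Hx. unfold sin4_over_cube, Rdiv.
    assert (0 < / x ^ 3) by (apply Rinv_0_lt_compat, pow_lt; lra).
    replace (sin x ^ 4) with (sin x ^ 2 * sin x ^ 2) by ring.
    pose proof (sin_sqr_bound x).
    assert (0 <= sin x ^ 2 * sin x ^ 2 <= 1) by nra.
    rewrite Rabs_right by nra. nra. }
assert (HA2 : 0 < A ^ 2) by nra.
assert (0 < / (2 * (A ^ 2) ^ 2)) by (apply Rinv_0_lt_compat; nra).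
assert (0 < / A ^ 2) by now apply Rinv_0_lt_compat.
rewrite (Rinv_mult 2 (A ^ 2)) in Htail. unfold Rdiv in *.
apply Rabs_le_between in H, Htail. apply Rabs_le. lra.
Qed.

Lemma RInt_sin4_over_id_bound (A : R) :
  1 <= A -> Rabs (RInt sin4_over_id 0 A) <= 1 + ln A.
Proof.
intros HA.
assert (E : forall a b, ex_RInt sin4_over_id a b).
{ intros. apply ex_RInt_of_continuous, continuous_sin4_over_id. }
pose proof (RInt_Chasles_R _ _ _ _ (E 0 1) (E 1 A)) as C.
rewrite <- C.
eapply Rle_trans; [apply Rabs_triang|]. apply Rplus_le_compat.
- apply (is_RInt_abs_le sin4_over_id (fun _ => 1) 0 1).
  + lra.
  + apply is_RInt_of_continuous, continuous_sin4_over_id.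
  + evar_last; [apply is_RInt_const_R | ring].
  + intros x Hx. pose proof (sin4_over_id_le x) as H. rewrite (Rabs_right x) in H by lra. lra.
- apply (is_RInt_abs_le sin4_over_id (fun x => / x) 1 A).
  + lra.
  + apply is_RInt_of_continuous, continuous_sin4_over_id.
  + replace (ln A) with (ln A - ln 1) by (rewrite ln_1; ring). apply is_RInt_inv; lra.
  + intros x Hx. unfold sin4_over_id, Rdiv.
    assert (0 < / x) by (apply Rinv_0_lt_compat; lra).
    replace (sin x ^ 4) with (sin x ^ 2 * sin x ^ 2) by ring.
    pose proof (sin_sqr_bound x).
    assert (0 <= sin x ^ 2 * sin x ^ 2 <= 1) by nra.
    rewrite Rabs_right by nra. nra.
Qed.

(** * The first absolute moment of the kernel *)

Lemma fejer_even (m : nat) (t : R) : fejer m (- t) = fejer m t.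
Proof.
assert (Hd : forall k, dirichlet k (- t) = dirichlet k t).
{ induction k as [|k IH]; cbn [dirichlet]; [reflexivity|].
  now rewrite IH, Ropp_mult_distr_r_reverse, cos_neg. }
induction m as [|m IH]; cbn [fejer]; [reflexivity|]. now rewrite IH, Hd.
Qed.

Lemma kernel_even (m : nat) (t : R) : kernel m (- t) = kernel m t.
Proof. unfold kernel. now rewrite fejer_even. Qed.

Lemma continuous_mul_kernel (m : nat) (g : R -> R) (t : R) :
  continuous g t -> continuous (fun s => g s * kernel m s) t.
Proof.
intros Hg. apply (continuous_mult (K := R_AbsRing) g (kernel m)); [exact Hg|].
apply continuous_kernel.
Qed.

Definition half_moment (m : nat) : R := RInt (fun t => t * kernel m t) 0 PI.

Lemma is_RInt_half_moment (m : nat) :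
  is_RInt (fun t => t * kernel m t) 0 PI (half_moment m).
Proof.
apply is_RInt_of_continuous. intros v.
apply (continuous_mul_kernel m (fun s => s)), continuous_id.
Qed.

Lemma is_RInt_abs_moment (m : nat) :
  is_RInt (fun t => Rabs t * kernel m t) (- PI) PI (2 * half_moment m).
Proof.
pose proof PI_RGT_0 as HPI. pose proof (is_RInt_half_moment m) as H.
assert (Hr : is_RInt (fun t => Rabs t * kernel m t) 0 PI (half_moment m)).
{ apply (is_RInt_ext (fun t => t * kernel m t)); [|exact H].
  intros x. rewrite Rmin_left, Rmax_right by lra. intros Hx.
  now rewrite Rabs_right by lra. }
assert (Hl : is_RInt (fun t => Rabs t * kernel m t) (- PI) 0 (half_moment m)).
{ assert (Ho : is_RInt (fun t => Rabs t * kernel m t) (- - PI) (- 0) (- half_moment m)).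
  { rewrite Ropp_involutive, Ropp_0. now apply (is_RInt_swap (V := R_NormedModule)). }
  apply (is_RInt_comp_opp (V := R_NormedModule)) in Ho.
  apply (is_RInt_opp (V := R_NormedModule)) in Ho.
  eapply is_RInt_eq; [exact Ho | |].
  - intros t. unfold opp; simpl. rewrite kernel_even, Rabs_Ropp. ring.
  - unfold opp; simpl. ring. }
replace (2 * half_moment m) with (plus (half_moment m) (half_moment m))
  by (unfold plus; simpl; ring).
exact (is_RInt_Chasles (V := R_NormedModule) _ _ _ _ _ _ Hl Hr).
Qed.


(** The second bound is weaker than Jordan's [2 u / PI <= sin u], but it follows
    from the first using no more than [PI <= 4]. *)
Lemma sin_lower_bounds (u : R) :
  0 < u <= PI / 2 -> u - u ^ 3 / 6 <= sin u /\ u / 3 <= sin u.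
Proof.
intros [H1 H2].
assert (Hu : u <= 2) by (pose proof PI_4; lra).
assert (H : u - u ^ 3 / 6 <= sin u).
{ destruct (pre_sin_bound u 0 ltac:(lra) ltac:(lra)) as [H _].
  unfold sin_approx, sin_term in H. simpl in H. lra. }
split; [exact H|]. nra.
Qed.

(** The numerator of the difference is [u^4 - s^4 <= (2/3) u^6] by
    [u - s <= u^3/6], and [u/3 <= s] bounds its denominator below by [u^8 / 81]. *)
Lemma inv_sin4_sub_inv_pow4 (u : R) :
  0 < u <= PI / 2 -> Rabs (/ sin u ^ 4 - / u ^ 4) <= 54 / u ^ 2.
Proof.
intros Hu. destruct (sin_lower_bounds u Hu) as [H1 H2].
pose proof (sin_lt_x u (proj1 Hu)) as H3. set (s := sin u) in *.
assert (Hu0 : 0 < u) by apply Hu. assert (Hs : 0 < s) by lra.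
assert (Hs4 : (u / 3) ^ 4 <= s ^ 4) by (apply pow_incr; lra).
assert (Hu4 : 0 < u ^ 4) by now apply pow_lt.
assert (Hlo : s ^ 4 <= u ^ 4) by (apply pow_incr; lra).
assert (Hd : u ^ 4 - s ^ 4 <= 2 / 3 * u ^ 6).
{ replace (u ^ 4 - s ^ 4) with ((u - s) * ((u + s) * (u ^ 2 + s ^ 2))) by ring.
  replace (2 / 3 * u ^ 6) with (u ^ 3 / 6 * (2 * u * (2 * u ^ 2))) by field.
  apply Rmult_le_compat; [lra | nra | lra |].
  apply Rmult_le_compat; nra. }
replace (/ s ^ 4 - / u ^ 4) with ((u ^ 4 - s ^ 4) / (s ^ 4 * u ^ 4)) by (field; lra).
assert (Hp : 0 < s ^ 4 * u ^ 4) by (apply Rmult_lt_0_compat; [now apply pow_lt | lra]).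
rewrite Rabs_right.
2:{ apply Rle_ge, Rmult_le_pos; [lra|]. now apply Rlt_le, Rinv_0_lt_compat. }
apply (Rmult_le_reg_r (s ^ 4 * u ^ 4)); [exact Hp|].
unfold Rdiv at 1. rewrite Rmult_assoc, Rinv_l, Rmult_1_r by lra.
apply Rle_trans with (2 / 3 * u ^ 6); [exact Hd|].
replace (2 / 3 * u ^ 6) with (54 / u ^ 2 * ((u / 3) ^ 4 * u ^ 4)) by (field; lra).
apply Rmult_le_compat_l.
- apply Rlt_le, Rdiv_lt_0_compat; [lra | now apply pow_lt].
- apply Rmult_le_compat_r; lra.
Qed.

Lemma is_RInt_dilate (f : R -> R) (m : nat) :
  (forall v, continuous f v) ->
  is_RInt (fun t => INR m / 2 * f (INR m * t / 2)) 0 PI (RInt f 0 (INR m * PI / 2)).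
Proof.
intros Hf.
assert (H := is_RInt_comp_lin (V := R_NormedModule) f (INR m / 2) 0 0 PI).
rewrite !Rplus_0_r, Rmult_0_r in H.
replace (INR m * PI / 2) with (INR m / 2 * PI) by field.
eapply is_RInt_eq.
- apply H. now apply is_RInt_of_continuous.
- intros t. unfold scal; simpl; unfold mult; simpl. do 2 f_equal. field.
- reflexivity.
Qed.

(** With [v = m t / 2], replacing [sin (t/2) ^ 4] by [(t/2) ^ 4] turns [t * kernel m t]
    into a dilate of [sin v ^ 4 / v ^ 3]; the loss is a dilate of [sin v ^ 4 / v],
    whose integral up to [m PI / 2] is only logarithmic. The factors are grouped so
    that [is_RInt_dilate] applies to both. *)
Lemma kernel_moment_pointwise (m : nat) (t : R) :
  (0 < m)%nat -> 0 < t < PI ->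
  Rabs (t * kernel m t
        + - (4 / INR m ^ 2) * (INR m / 2 * sin4_over_cube (INR m * t / 2)))
  <= 0 + 216 / INR m ^ 4 * (INR m / 2 * sin4_over_id (INR m * t / 2)).
Proof.
intros Hm Ht.
assert (Hm' : 0 < INR m) by now apply lt_0_INR.
pose proof (inv_sin4_sub_inv_pow4 (t / 2) ltac:(lra)) as Hu.
assert (Hs : 0 < sin (t / 2)) by (apply sin_gt_0; lra).
set (u := t / 2) in *.
assert (Hu0 : 0 < u) by (unfold u; lra).
replace t with (2 * u) by (unfold u; field).
replace (INR m * (2 * u) / 2) with (INR m * u) by field.
pose proof (fejer_mul_sin_sqr m (2 * u)) as HF.
replace (2 * u / 2) with u in HF by field.
replace (INR m * (2 * u) / 2) with (INR m * u) in HF by field.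
assert (HK : kernel m (2 * u) = sin (INR m * u) ^ 4 / INR m ^ 4 * / sin u ^ 4).
{ unfold kernel. replace (sin (INR m * u) ^ 4) with ((sin (INR m * u) ^ 2) ^ 2) by ring.
  rewrite <- HF. field. lra. }
rewrite HK. unfold sin4_over_cube, sin4_over_id.
match goal with |- Rabs ?x <= _ =>
  replace x with (2 * u * (sin (INR m * u) ^ 4 / INR m ^ 4) * (/ sin u ^ 4 - / u ^ 4))
    by (field; lra) end.
match goal with |- _ <= ?x =>
  replace x with (2 * u * (sin (INR m * u) ^ 4 / INR m ^ 4) * (54 / u ^ 2))
    by (field; lra) end.
assert (Hpos : 0 <= 2 * u * (sin (INR m * u) ^ 4 / INR m ^ 4)).
{ apply Rmult_le_pos; [lra|]. apply Rmult_le_pos.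
  - replace (sin (INR m * u) ^ 4) with ((sin (INR m * u) ^ 2) ^ 2) by ring. apply pow2_ge_0.
  - apply Rlt_le, Rinv_0_lt_compat, pow_lt, Hm'. }
rewrite Rabs_mult, (Rabs_right (2 * u * _)) by lra.
now apply Rmult_le_compat_l.
Qed.

Lemma half_moment_asymptotic (m : nat) :
  (0 < m)%nat ->
  Rabs (half_moment m - 4 * ln 2 / INR m ^ 2)
  <= (268 + 216 * ln (2 * INR m)) / INR m ^ 4.
Proof.
intros Hm.
assert (Hm1 : 1 <= INR m) by (apply (le_INR 1); lia).
pose proof PI2_1. pose proof PI_4. pose proof PI_RGT_0.
set (A := INR m * PI / 2).
assert (HA : INR m <= A) by (unfold A; nra).
assert (HA2 : A <= 2 * INR m) by (unfold A; nra).
pose proof (is_RInt_abs_le _ _ 0 PI _ _ (Rlt_le _ _ PI_RGT_0)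
  (is_RInt_comb _ _ _ _ (- (4 / INR m ^ 2)) _ _ (is_RInt_half_moment m)
     (is_RInt_dilate _ m continuous_sin4_over_cube))
  (is_RInt_comb (fun _ => 0) _ _ _ (216 / INR m ^ 4) _ _
     (is_RInt_const_R 0 0 PI)
     (is_RInt_dilate _ m continuous_sin4_over_id))
  (fun t Ht => kernel_moment_pointwise m t Hm Ht)) as H2.
fold A in H2. cbv beta in H2.
rewrite Rmult_0_r, Rplus_0_l in H2.
pose proof (RInt_sin4_over_cube A ltac:(lra)) as H3.
pose proof (RInt_sin4_over_id_bound A ltac:(lra)) as H4.
apply Rabs_le_between in H4. destruct H4 as [_ H4].
assert (Hln : ln A <= ln (2 * INR m)) by (apply ln_le; lra).
set (q := / INR m ^ 2).
assert (Hq : 0 < q) by (apply Rinv_0_lt_compat, pow_lt; lra).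
assert (Hq4 : / INR m ^ 4 = q ^ 2) by (unfold q; field; lra).
assert (HAq : / A ^ 2 <= q) by (apply Rinv_le_contravar; [apply pow_lt; lra | apply pow_incr; lra]).
unfold Rdiv in *. rewrite Hq4 in *. fold q in H2 |- *.
set (I := RInt sin4_over_cube 0 A) in *.
assert (Hq2 : 0 < q ^ 2) by now apply pow_lt.
assert (H5 : 216 * q ^ 2 * RInt sin4_over_id 0 A <= 216 * q ^ 2 * (1 + ln (2 * INR m)))
  by (apply Rmult_le_compat_l; lra).
assert (H6 : Rabs (I - ln 2) <= 13 * q) by lra.
assert (H7 : Rabs (4 * q * (I - ln 2)) <= 4 * q * (13 * q)).
{ rewrite Rabs_mult, (Rabs_right (4 * q)) by lra. apply Rmult_le_compat_l; lra. }
replace (half_moment m - 4 * ln 2 * q)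
  with (half_moment m + - (4 * q) * I + 4 * q * (I - ln 2)) by ring.
eapply Rle_trans; [apply Rabs_triang|].
apply Rle_trans with (216 * q ^ 2 * (1 + ln (2 * INR m)) + 4 * q * (13 * q)); [lra|].
right. ring.
Qed.

(** The average of [Rabs t] against the normalized kernel: the largest error that
    a function of Lipschitz constant [1] can have. *)
Definition lipschitz_error (m : nat) : R :=
  2 * half_moment m / kernel_mass m.

(** The main terms are [3 m^3 / (PI (2 m^2 + 1)) * 4 ln 2 / m^2] and
    [6 ln 2 / (PI m)]; they differ by [6 ln 2 / (PI m (2 m^2 + 1))], that is
    [O(1/m^3)], because the mass is known exactly. *)
Lemma lipschitz_error_asymptotic (m : nat) :
  (0 < m)%nat ->
  Rabs (lipschitz_error m - 12 * ln 2 / PI * (1 / (2 * INR m)))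
  <= (270 + 216 * ln (2 * INR m)) / INR m ^ 3.
Proof.
intros Hm. pose proof (half_moment_asymptotic m Hm) as H.
assert (Hm1 : 1 <= INR m) by (apply (le_INR 1); lia).
pose proof PI2_1 as HPI.
assert (Hm2 : 0 < 2 * INR m ^ 2 + 1) by nra.
set (x := half_moment m - 4 * ln 2 / INR m ^ 2) in *.
assert (Hln2 : 0 < ln 2 < 1).
{ split; [rewrite <- ln_1; apply ln_increasing; lra|].
  apply exp_lt_inv. rewrite exp_ln by lra. pose proof (exp_ineq1 1 ltac:(lra)). lra. }
assert (Hl : 0 <= ln (2 * INR m)) by (rewrite <- ln_1; apply ln_le; lra).
replace (lipschitz_error m - 12 * ln 2 / PI * (1 / (2 * INR m)))
  with (3 * INR m ^ 3 / (PI * (2 * INR m ^ 2 + 1)) * x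
        + - (6 * ln 2 / (PI * (2 * INR m ^ 2 + 1) * INR m))).
2:{ unfold x, lipschitz_error, kernel_mass. field. repeat split; lra. }
assert (H1 : 0 <= 3 * INR m ^ 3 / (PI * (2 * INR m ^ 2 + 1)) <= INR m).
{ assert (0 < INR m ^ 3) by (apply pow_lt; lra).
  assert (0 < PI * (2 * INR m ^ 2 + 1)) by nra. split.
  - apply Rlt_le, Rdiv_lt_0_compat; lra.
  - apply Rle_div_l; [lra|]. simpl. nra. }
assert (H2 : 0 <= 6 * ln 2 / (PI * (2 * INR m ^ 2 + 1) * INR m) <= 6 / (4 * INR m ^ 3)).
{ assert (0 < INR m ^ 3) by (apply pow_lt; lra).
  assert (4 * INR m ^ 3 <= PI * (2 * INR m ^ 2 + 1) * INR m).
  { simpl. nra. }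
  split.
  - apply Rlt_le, Rdiv_lt_0_compat; lra.
  - apply Rmult_le_compat; [lra | | lra |].
    + apply Rlt_le, Rinv_0_lt_compat. lra.
    + apply Rinv_le_contravar; lra. }
assert (Hx : Rabs (3 * INR m ^ 3 / (PI * (2 * INR m ^ 2 + 1)) * x)
             <= INR m * ((268 + 216 * ln (2 * INR m)) / INR m ^ 4)).
{ rewrite Rabs_mult, (Rabs_right (_ / _)) by lra.
  apply Rmult_le_compat; [lra | apply Rabs_pos | lra | exact H]. }
eapply Rle_trans; [apply Rabs_triang|].
rewrite Rabs_Ropp, (Rabs_right (6 * ln 2 / _)) by lra.
replace (INR m * ((268 + 216 * ln (2 * INR m)) / INR m ^ 4))
  with ((268 + 216 * ln (2 * INR m)) / INR m ^ 3) in Hx by (field; lra).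
apply Rle_trans with ((268 + 216 * ln (2 * INR m)) / INR m ^ 3 + 6 / (4 * INR m ^ 3)); [lra|].
replace (6 / (4 * INR m ^ 3)) with (3 / 2 / INR m ^ 3) by (field; lra).
unfold Rdiv. rewrite <- Rmult_plus_distr_r.
apply Rmult_le_compat_r; [apply Rlt_le, Rinv_0_lt_compat, pow_lt; lra | lra].
Qed.

(** * Approximation of Lipschitz functions *)

Definition remainder (L : R) (n : nat) : R :=
  L * lipschitz_error (n / 2 + 1) - 12 * ln 2 / PI * (L / (INR n + 2)).

Lemma half_even (n : nat) : Nat.Even n -> 2 * INR (n / 2 + 1) = INR n + 2.
Proof.
intros [k ->]. rewrite (Nat.mul_comm 2), Nat.div_mul by lia.
rewrite plus_INR, mult_INR. simpl. ring.
Qed.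

Lemma remainder_bigO (L : R) :
  0 < L -> bigO_even (remainder L) (fun n => ln (INR n) / INR n ^ 3).
Proof.
(* [702 = 270 + 2 * 216] from [1 <= ln n] and [ln (2m) <= 2 ln n]; [8] from [m >= n / 2] *)
intros HL. exists (8 * 702 * L), 3%nat. intros n Hn3 Hn.
pose proof (half_even n Hn) as Hm. set (m := (n / 2 + 1)%nat) in *.
assert (Hmpos : (0 < m)%nat) by (unfold m; lia).
assert (Hn' : 3 <= INR n) by (replace 3 with (INR 3) by (simpl; ring); now apply le_INR).
assert (Hln : 1 <= ln (INR n)).
{ rewrite <- (ln_exp 1). apply ln_le; [apply exp_pos|]. pose proof exp_le_3. lra. }
assert (Hln2 : ln (2 * INR m) <= 2 * ln (INR n)).
{ replace (2 * ln (INR n)) with (ln (INR n) + ln (INR n)) by ring.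
  rewrite <- ln_mult by lra. apply ln_le; nra. }
assert (Hn3' : 0 < INR n ^ 3) by (apply pow_lt; lra).
unfold remainder. fold m.
replace (L * lipschitz_error m - 12 * ln 2 / PI * (L / (INR n + 2)))
  with (L * (lipschitz_error m - 12 * ln 2 / PI * (1 / (2 * INR m)))).
2:{ rewrite Hm. field. split; [lra | apply PI_neq0]. }
rewrite Rabs_mult, (Rabs_right L) by lra.
rewrite (Rabs_right (ln (INR n) / INR n ^ 3)).
2:{ apply Rle_ge, Rlt_le, Rdiv_lt_0_compat; lra. }
replace (8 * 702 * L * (ln (INR n) / INR n ^ 3))
  with (L * (702 * ln (INR n) / (INR n / 2) ^ 3)) by (field; lra).
apply Rmult_le_compat_l; [lra|].
eapply Rle_trans; [apply (lipschitz_error_asymptotic m Hmpos)|].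
apply Rle_trans with (702 * ln (INR n) / INR m ^ 3).
- unfold Rdiv. apply Rmult_le_compat_r; [|lra].
  apply Rlt_le, Rinv_0_lt_compat, pow_lt. lra.
- apply Rmult_le_compat_l; [lra|]. apply Rinv_le_contravar.
  + apply pow_lt. lra.
  + apply pow_incr. lra.
Qed.

Lemma lipschitz_continuous (L : R) (f : R -> R) (x : R) :
  0 < L -> lipschitz L f -> continuous f x.
Proof.
intros HL Hf. apply continuity_pt_filterlim. intros eps Heps.
exists (eps / L). split; [now apply Rdiv_lt_0_compat|].
intros y [_ Hy]. simpl in *. unfold Rdist in *.
apply Rle_lt_trans with (1 := Hf y x). rewrite Rmult_comm. now apply Rlt_div_r.
Qed.

Lemma is_RInt_jackson_approx (L : R) (f : R -> R) (n : nat) (x : R) :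
  0 < L -> lipschitz L f ->
  let m := (n / 2 + 1)%nat in
  is_RInt (fun t => f (x - t) * kernel m t) (- PI) PI
    (jackson_approx f n x * kernel_mass m).
Proof.
intros HL Hf m. assert (Hm : (0 < m)%nat) by (unfold m; lia).
pose proof (kernel_mass_pos m Hm) as HN0. set (N := kernel_mass m) in *.
assert (HN : integral_R (jackson m) = N).
{ apply (integral_R_supported _ (kernel m)).
  - now apply is_RInt_kernel.
  - intros t. now apply jackson_eq_kernel.
  - apply jackson_outside. }
assert (HI : exists I : R, is_RInt (fun t => f (x - t) * kernel m t) (- PI) PI I).
{ apply ex_RInt_of_continuous. intros t.
  apply (continuous_mul_kernel m (fun s => f (x - s))).
  apply (continuous_comp (fun s => x - s) f).
  - apply (continuous_minus (V := R_NormedModule) (fun _ => x) (fun s => s));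
      [apply continuous_const | apply continuous_id].
  - now apply (lipschitz_continuous L). }
destruct HI as [I HI].
replace (jackson_approx f n x * N) with I; [exact HI|].
replace (jackson_approx f n x) with (0 + / N * I); [field; lra|].
symmetry. unfold jackson_approx, convolution.
apply (integral_R_supported _ (fun t => 0 + / N * (f (x - t) * kernel m t))).
- apply is_RInt_comb; [|exact HI]. evar_last; [apply is_RInt_const_R | ring].
- intros t Ht. unfold jackson_hat. fold m. rewrite HN, jackson_eq_kernel by assumption.
  field. lra.
- intros t Ht. unfold jackson_hat. fold m. rewrite jackson_outside by exact Ht.
  unfold Rdiv. ring.
Qed.

(** Since the normalized kernel is nonnegative of mass one,
    [f x - p x] is the average of [f x - f (x - t)], of size at most [L * Rabs t]. *)
Lemma jackson_approx_error_le (L : R) (f : R -> R) (n : nat) (x : R) :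
  0 < L -> lipschitz L f ->
  Rabs (f x - jackson_approx f n x) <= L * lipschitz_error (n / 2 + 1).
Proof.
intros HL Hf. pose proof (is_RInt_jackson_approx L f n x HL Hf) as Hp. cbv zeta in Hp.
set (m := (n / 2 + 1)%nat) in *. assert (Hm : (0 < m)%nat) by (unfold m; lia).
pose proof (is_RInt_kernel m Hm) as HK. unfold lipschitz_error.
pose proof PI_RGT_0 as HPI.
pose proof (kernel_mass_pos m Hm) as HN0. set (N := kernel_mass m) in *.
apply (Rmult_le_reg_r N); [exact HN0|].
replace (L * (2 * half_moment m / N) * N) with (0 + L * (2 * half_moment m)) by (field; lra).
rewrite <- (Rabs_right N) at 1 by lra. rewrite <- Rabs_mult.
replace ((f x - jackson_approx f n x) * N)
  with (0 + f x * N + (-1) * (jackson_approx f n x * N)) by ring.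
assert (H0 : is_RInt (fun _ => 0) (- PI) PI 0)
  by (evar_last; [apply is_RInt_const_R | ring]).
refine (is_RInt_abs_le _ _ (- PI) PI _ _ _
  (is_RInt_comb _ _ _ _ (-1) _ _ (is_RInt_comb _ _ _ _ (f x) _ _ H0 HK) Hp)
  (is_RInt_comb _ _ _ _ L _ _ H0 (is_RInt_abs_moment m)) _); [lra|].
intros t _. cbv beta. pose proof (kernel_nonneg m t) as Hk.
replace (0 + f x * kernel m t + -1 * (f (x - t) * kernel m t))
  with ((f x - f (x - t)) * kernel m t) by ring.
rewrite Rabs_mult, (Rabs_right (kernel m t)) by lra.
replace (0 + L * (Rabs t * kernel m t)) with (L * Rabs t * kernel m t) by ring.
apply Rmult_le_compat_r; [exact Hk|].
replace (L * Rabs t) with (L * Rabs (x - (x - t))); [apply Hf|].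
do 2 f_equal. ring.
Qed.

(** * The extremal function *)

Definition triangle_wave (L : R) : R -> R := periodic_extension (2 * PI) (fun x => L * Rabs x).

(** The triangle wave is [L] times the distance to the lattice [2 PI Z]: the
    translate chosen by [periodic_extension] is a nearest one. Being a distance to a
    set, it is Lipschitz. *)
Lemma triangle_wave_le (L x : R) (k : Z) :
  0 < L -> triangle_wave L x <= L * Rabs (x - 2 * PI * IZR k).
Proof.
intros HL. unfold triangle_wave, periodic_extension.
apply Rmult_le_compat_l; [lra|]. pose proof PI_RGT_0 as HPI.
destruct (base_Int_part (x / (2 * PI) + / 2)) as [H1 H2].
set (j := Int_part (x / (2 * PI) + / 2)) in *.
assert (Hr : - PI <= x - 2 * PI * IZR j <= PI).
{ assert (E : x = x / (2 * PI) * (2 * PI)) by (field; lra).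
  set (y := x / (2 * PI)) in *. rewrite E. split; nra. }
destruct (Z.lt_trichotomy j k) as [H|[->|H]]; [|lra|].
- assert (Hk : IZR j + 1 <= IZR k) by (rewrite <- plus_IZR; apply IZR_le; lia).
  apply Rabs_le. rewrite Rabs_left1 by nra. nra.
- assert (Hk : IZR k + 1 <= IZR j) by (rewrite <- plus_IZR; apply IZR_le; lia).
  apply Rabs_le. rewrite Rabs_right by nra. nra.
Qed.

Lemma triangle_wave_lipschitz (L : R) : 0 < L -> lipschitz L (triangle_wave L).
Proof.
intros HL.
assert (Hone : forall x y, triangle_wave L x - triangle_wave L y <= L * Rabs (x - y)).
{ intros x y.
  pose proof (triangle_wave_le L x (Int_part (y / (2 * PI) + / 2)) HL) as H.
  unfold triangle_wave at 2, periodic_extension.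
  set (s := 2 * PI * IZR (Int_part (y / (2 * PI) + / 2))) in *.
  pose proof (Rabs_triang (x - y) (y - s)) as Ht.
  replace (x - y + (y - s)) with (x - s) in Ht by ring. nra. }
intros x y. pose proof (Hone x y). pose proof (Hone y x) as H'.
rewrite Rabs_minus_sym in H'. apply Rabs_le. lra.
Qed.

Lemma triangle_wave_on_period (L x : R) :
  - PI <= x <= PI -> triangle_wave L x = L * Rabs x.
Proof.
intros Hx. pose proof PI_RGT_0. apply (periodic_extension_agrees (2 * PI) (fun y => L * Rabs y)).
- lra.
- now rewrite Rabs_Ropp.
- lra.
Qed.

(** At [0] the Lipschitz estimate [Rabs (f 0 - f (-t)) <= L * Rabs t] is an
    equality for every [t] in the period, hence so is the bound on the error. *)
Lemma triangle_wave_error (L : R) (n : nat) :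
  0 < L ->
  Rabs (triangle_wave L 0 - jackson_approx (triangle_wave L) n 0)
  = L * lipschitz_error (n / 2 + 1).
Proof.
intros HL. pose proof PI_RGT_0 as HPI.
pose proof (is_RInt_jackson_approx L _ n 0 HL (triangle_wave_lipschitz L HL)) as Hp.
cbv zeta in Hp. set (m := (n / 2 + 1)%nat) in *.
assert (Hm : (0 < m)%nat) by (unfold m; lia).
set (p := jackson_approx (triangle_wave L) n 0) in *.
assert (HM : is_RInt (fun t => triangle_wave L (0 - t) * kernel m t) (- PI) PI
               (L * (2 * half_moment m))).
{ apply (is_RInt_ext (fun t => scal L (Rabs t * kernel m t))).
  - intros t. rewrite Rmin_left, Rmax_right by lra. intros Ht.
    rewrite triangle_wave_on_period by lra.
    rewrite Rminus_0_l, Rabs_Ropp. unfold scal; simpl; unfold mult; simpl. ring.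
  - apply (is_RInt_scal (V := R_NormedModule)). apply is_RInt_abs_moment. }
pose proof (is_RInt_unique (V := R_CompleteNormedModule) _ _ _ _ Hp) as E1.
rewrite (is_RInt_unique (V := R_CompleteNormedModule) _ _ _ _ HM) in E1.
rewrite triangle_wave_on_period, Rabs_R0, Rmult_0_r, Rminus_0_l, Rabs_Ropp by lra.
unfold lipschitz_error.
pose proof (kernel_mass_pos m Hm) as HN0. set (N := kernel_mass m) in *.
assert (HMpos : 0 <= half_moment m).
{ apply (is_RInt_le (fun _ => 0) (fun t => t * kernel m t) 0 PI).
  - lra.
  - evar_last; [apply is_RInt_const_R | ring].
  - apply is_RInt_half_moment.
  - intros t Ht. apply Rmult_le_pos; [lra | apply kernel_nonneg]. }
assert (Ep : p = L * (2 * half_moment m / N)).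
{ apply (Rmult_eq_reg_r N); [|lra]. rewrite <- E1. field. lra. }
rewrite Rabs_right; [exact Ep|]. rewrite Ep. apply Rle_ge, Rmult_le_pos; [lra|].
apply Rmult_le_pos; [lra | now apply Rlt_le, Rinv_0_lt_compat].
Qed.

(** * The supremum *)

Lemma sup_dist_le (f g : R -> R) (c : R) :
  (forall x, Rabs (f x - g x) <= c) -> Rbar_le (sup_dist f g) c.
Proof.
intros H. apply (proj2 (Lub_Rbar_correct (fun y => exists x : R, y = Rabs (f x - g x)))).
intros y [x ->]. apply H.
Qed.

Lemma sup_dist_attained (f g : R -> R) (c x0 : R) :
  (forall x, Rabs (f x - g x) <= c) -> Rabs (f x0 - g x0) = c -> sup_dist f g = c.
Proof.
intros H H0. apply Rbar_le_antisym; [now apply sup_dist_le|].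
apply (proj1 (Lub_Rbar_correct (fun y => exists x : R, y = Rabs (f x - g x)))).
now exists x0.
Qed.

Theorem theorem1p2 (L : R) (HL : 0 < L) :
  (exists r : nat -> R,
     bigO_even r (fun n => ln (INR n) / INR n ^ 3) /\
     forall f : R -> R, periodic (2 * PI) f -> lipschitz L f ->
     forall n : nat, (2 <= n)%nat -> Nat.Even n ->
       Rbar_le (sup_dist f (jackson_approx f n))
               (Finite (12 * ln 2 / PI * (L / (INR n + 2)) + r n)))
  /\
  (exists r : nat -> R,
     bigO_even r (fun n => ln (INR n) / INR n ^ 3) /\
     let f := periodic_extension (2 * PI) (fun x => L * Rabs x) in
     forall n : nat, (2 <= n)%nat -> Nat.Even n ->
       sup_dist f (jackson_approx f n) =
         Finite (12 * ln 2 / PI * (L / (INR n + 2)) + r n)).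
Proof.
assert (Hr : forall n, 12 * ln 2 / PI * (L / (INR n + 2)) + remainder L n
                       = L * lipschitz_error (n / 2 + 1)) by (intros n; unfold remainder; ring).
split; exists (remainder L); (split; [now apply remainder_bigO|]).
- intros f _ Hf n _ _. rewrite Hr. apply sup_dist_le.
  intros x. now apply jackson_approx_error_le.
- intros f n _ _. rewrite Hr. apply (sup_dist_attained _ _ _ 0).
  + intros x. apply jackson_approx_error_le; [exact HL | now apply triangle_wave_lipschitz].
  + now apply triangle_wave_error.
Qed.
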